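(* Let $A$ be an infinite set, $(K,+)$ an abelian group with $|K|\ge2$, and $V$ a visibility graph on $A$. If the simultaneous hat game $\mathcal{G}=(A,K,V,1)$ has a predictor $P$ which is both finite error (for every $f\in K^A$, $P(f)$ and $f$ differ at only finitely many $a\in A$) and robust (whenever $f,g\in K^A$ differ at only finitely many points, $P(f)=P(g)$), then there exists a $K^A$-parity function.
   Context: For a set $X$ and abelian group $(G,+)$, a $G^X$-parity function is a map $\phi:G^X\to G$ such that for all $f\in G^X$, $x\in X$ and $g_1,g_2\in G$, $\phi(f[x\mapsto g_1])-\phi(f[x\mapsto g_2])=g_2-g_1$, where $f[x\mapsto g]$ is $f$ with its value at $x$ changed to $g$. A visibility graph on $A$ is $V\subseteq A^2$ with no loops; $V(a)=\{b:(a,b)\in V\}$ is the set of prisoners whose hats $a$ sees. In the simultaneous game $(A,K,V,1)$, a strategy for prisoner $a$ is a function $S_a:K^{V(a)}\to K$, and a predictor is a map $P:K^A\to K^A$ of the form $P(f)(a)=S_a(f\restriction V(a))$ for some family of strategies $(S_a)_{a\in A}$. *)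

(* Defs.v *)
From mathcomp Require Import all_boot all_order all_algebra.
From mathcomp Require Import boolp classical_sets functions cardinality.

Set Implicit Arguments.
Unset Strict Implicit.
Unset Printing Implicit Defensive.

Import GRing.Theory.
Local Open Scope classical_set_scope.
Local Open Scope ring_scope.

Definition is_parity_function (X : eqType) (G : zmodType)
    (phi : (X -> G) -> G) : Prop :=
  forall (f : X -> G) (x : X) (g1 g2 : G),
    phi [eta f with x |-> g1] - phi [eta f with x |-> g2] = g2 - g1.

Definition visibility_graph (A : Type) (V : set (A * A)) : Prop :=
  forall a : A, ~ V (a, a).

Definition visible (A : Type) (V : set (A * A)) (a : A) : set A :=
  [set b | V (a, b)].

(* In [strategy V K a], the set [visible V a] is coerced to the subtype of its
   elements, so a strategy for [a] is a function from K^(V(a)) to K. *)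
Definition strategy (A : Type) (V : set (A * A)) (K : Type) (a : A) : Type :=
  (visible V a -> K) -> K.

(* [sigL B f] is the restriction of [f] to [B]. *)
Definition is_predictor (A K : Type) (V : set (A * A))
    (P : (A -> K) -> A -> K) : Prop :=
  exists S : forall a : A, strategy V K a,
    forall (f : A -> K) (a : A), P f a = S a (sigL (visible V a) f).

Definition differ_finitely (A K : Type) (f g : A -> K) : Prop :=
  finite_set [set a | f a <> g a].

Definition finite_error (A K : Type) (P : (A -> K) -> A -> K) : Prop :=
  forall f : A -> K, differ_finitely (P f) f.

Definition robust (A K : Type) (P : (A -> K) -> A -> K) : Prop :=
  forall f g : A -> K, differ_finitely f g -> P f = P g.

(* Main.v *)
Require Import Defs.
From mathcomp Require Import all_boot all_order all_algebra.
From mathcomp Require Import boolp classical_sets functions cardinality.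
From mathcomp Require Import fsbigop.

(** The parity function is phi(f) = sum_a (P(f)(a) - f(a)), a finite sum because
    [P] is finite error. Changing [f] at one point [x] leaves P(f) unchanged by
    robustness, so only the summand -f(x) changes. *)

Import GRing.Theory.
Local Open Scope classical_set_scope.
Local Open Scope ring_scope.

(* [{classic A}] equips [A] with the choice structure that finitely supported
   sums require. *)
Definition total_error {A : Type} {K : zmodType} (P : (A -> K) -> A -> K)
    (f : A -> K) : K :=
  \sum_(a \in [set: {classic A}]) (P f a - f a).

Lemma total_error_parity (A : eqType) (K : zmodType) (P : (A -> K) -> A -> K) :
  finite_error P -> robust P -> is_parity_function (total_error P).
Proof.
move=> finP robP f x g1 g2.
have eqP12 : P [eta f with x |-> g1] = P [eta f with x |-> g2].
  apply: robP; apply: (@sub_finite_set _ _ [set x]) => // a /=.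
  by case: eqVneq.
(* By [eqP12], one index set serves both sums; adjoining [x] absorbs whatever value is placed
   there. *)
pose D := [set a : {classic A} | P [eta f with x |-> g1] a <> f a] `|` [set x].
(* A sum with infinite support is 0 by default, so finiteness matters for splitting off a summand.
   Finite error is applied to the modified function, which agrees with [f] away from [x]. *)
have finD : finite_set D.
  rewrite finite_setU; split; last exact: finite_set1.
  apply: (@sub_finite_set _ _ ([set a | P [eta f with x |-> g1] a
    <> [eta f with x |-> g1] a] `|` [set x])).
    by move=> a /= neq_Pf; case: eqVneq => [->|_]; [right|left].
  by rewrite finite_setU; split; [exact: finP | exact: finite_set1].
(* On the right only [- g] depends on [g], so subtracting the cases [g1] and [g2] cancels everything
   else. *)
have splitx g : P [eta f with x |-> g] = P [eta f with x |-> g1] ->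
    total_error P [eta f with x |-> g] =
    P [eta f with x |-> g1] x - g +
    \sum_(a \in D `\ (x : {classic A})) (P [eta f with x |-> g1] a - f a).
  move=> eqPg; rewrite /total_error eqPg -(fsbig_widen D) //=; last first.
    (* A point outside [D] is not [x] and is guessed correctly, so its summand is 0. *)
    move=> a [_ /not_orP[/contrapT eqa neq_ax]] /=.
    by case: eqVneq => [/neq_ax//|_]; rewrite eqa subrr.
  rewrite (fsbigD1 (x : {classic A})) //=; last by right.
  rewrite eqxx; congr (_ + _); apply: eq_fsbigr => a.
  by rewrite inE => -[_ /= neq_ax]; case: eqVneq => [/neq_ax|].
rewrite (splitx g1) // (splitx g2) //.
by rewrite opprD addrACA subrr addr0 opprB addrC addrA subrK.
Qed.

Theorem theorem6p3 (A : eqType) (K : zmodType) (V : set (A * A))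
    (hA : infinite_set [set: A]%classic)
    (hK : exists k1 k2 : K, k1 <> k2)
    (hV : visibility_graph V)
    (hP : exists P : (A -> K) -> A -> K,
        is_predictor V P /\ finite_error P /\ robust P) :
  exists phi : (A -> K) -> K, is_parity_function phi.
Proof.
have [P [_ [finP robP]]] := hP.
by exists (total_error P); apply: total_error_parity.
Qed.
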